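(* Let $n\ge1$, let $q_1,\ldots,q_n\ge 2$ be integers, let $t$ be an integer with $0\le t\le n$, and let $q$ be the harmonic mean of the $q_i$, i.e. $\frac1q=\frac1n\sum_{i=1}^n\frac1{q_i}$. If $C$ is an orthogonal array with parameters $\mathrm{OA}(N,q_1\cdot\ldots\cdot q_n,t)$, then $$N\ \ge\ q_1q_2\cdots q_n\Big(1-\big(1-\tfrac1q\big)\tfrac{n}{t+1}\Big).\qquad(\star)$$ Moreover, a multiset $C$ of vertices of the graph $H=H(q_1\cdot\ldots\cdot q_n)$ is an $\mathrm{OA}(|C|,q_1\cdot\ldots\cdot q_n,t)$ meeting $(\star)$ (with $N=|C|$) with equality if and only if $C$ is a simple set (no element has multiplicity more than $1$) and a $\{k;-\theta_{t+1}\}$-CR code in $H$, where $k=Qn(1-\frac1q)$ (the degree of $H$), $\theta_{t+1}=k-(t+1)Q$, and $Q=\mathrm{lcm}(q_1,\ldots,q_n)$.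
   Context: For a positive integer $s$, $[s]=\{0,\ldots,s-1\}$. Graphs are multigraphs, and numbers of edges (and degrees) are counted with multiplicity. Cardinalities of multisets count multiplicities. The graph $H(q_1\cdot\ldots\cdot q_n)$ has vertex set $V=[q_1]\times\cdots\times[q_n]$; two $n$-tuples are joined by an edge of multiplicity $Q/q_i$ if they differ in exactly one position, namely the $i$th, where $Q=\mathrm{lcm}(q_1,\ldots,q_n)$; all other pairs are non-adjacent. Orthogonal array: a nonempty multiset $C$ of elements of $V$ is an orthogonal array of strength $t$, denoted $\mathrm{OA}(|C|,q_1\cdot\ldots\cdot q_n,t)$, if for any distinct $i_1,\ldots,i_t\in\{1,\ldots,n\}$ and any $a_j\in[q_{i_j}]$, $j=1,\ldots,t$, the number (with multiplicity) of $(x_1,\ldots,x_n)\in C$ with $x_{i_j}=a_j$ for all $j=1,\ldots,t$ equals $|C|/(q_{i_1}\cdots q_{i_t})$. $\{b;c\}$-CR code (completely regular code with covering radius $1$ and intersection array $\{b;c\}$), where $b,c>0$: a set $C$ of vertices of a regular graph with vertex set $V$ such that every vertex in $C$ is connected with $V\setminus C$ by exactly $b$ edges and every vertex in $V\setminus C$ is connected with $C$ by exactly $c$ edges. (In particular, if $c\le 0$ there is no $\{b;c\}$-CR code.) *)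

(* Defs.v *)
From HB Require Import structures.
From mathcomp Require Import all_boot all_order all_algebra.
From mathcomp Require Export finmap multiset.

Set Implicit Arguments.
Unset Strict Implicit.
Unset Printing Implicit Defensive.

Import Order.TTheory GRing.Theory Num.Theory.

Local Open Scope ring_scope.
Local Open Scope mset_scope.

(* [emult G x y] is the multiplicity of the edge xy (0 if non-adjacent). *)
Record multigraph (T : finType) := Multigraph {
  emult :> T -> T -> nat;
  emult_sym : forall x y, emult x y = emult y x;
  emult_irr : forall x, emult x x = 0%N
}.

Definition edges_to (T : finType) (G : multigraph T) (x : T) (S : {set T}) : nat :=
  (\sum_(y in S) G x y)%N.

Definition regular_graph (T : finType) (G : multigraph T) : Prop :=
  exists d : nat, forall x, edges_to G x [set: T] = d.

(* [b] and [c] are rational because they are given by formulas with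
   division; the last two clauses force them to be integers whenever they
   apply to some vertex. *)
Definition CR_code (T : finType) (G : multigraph T) (b c : rat) (C : {set T}) :
    Prop :=
  [/\ regular_graph G, 0 < b, 0 < c,
      forall x, x \in C -> (edges_to G x (~: C))%:R = b
    & forall x, x \notin C -> (edges_to G x C)%:R = c].

Section MixedHamming.
Variables (n : nat) (q : 'I_n -> nat).

Definition vertex := {dffun forall i : 'I_n, 'I_(q i)}.

HB.instance Definition _ :=
  Finite.copy vertex {dffun forall i : 'I_n, 'I_(q i)}.

Definition lcm_all : nat := \big[lcmn/1%N]_(i < n) q i.

Definition harmonic_mean : rat := n%:R / \sum_(i < n) (q i)%:R^-1.

(* At most one index [i] contributes to the sum. *)
Definition H_mult (x y : vertex) : nat :=
  (\sum_(i < n | [set j | x j != y j] == [set i]) lcm_all %/ q i)%N.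

Lemma H_mult_sym x y : H_mult x y = H_mult y x.
Proof.
rewrite /H_mult; have -> // : [set j | x j != y j] = [set j | y j != x j].
by apply/setP => j; rewrite !inE eq_sym.
Qed.

Lemma H_mult_irr x : H_mult x x = 0%N.
Proof.
apply: big1 => i /eqP/setP/(_ i).
by rewrite !inE !eqxx.
Qed.

Definition H : multigraph vertex := Multigraph H_mult_sym H_mult_irr.

(* [size] and [count] on a multiset count with multiplicity. *)
Definition orthogonal_array (N t : nat) (C : {mset vertex}) : Prop :=
  [/\ C != mset0, size C = N
    & forall idx : 'I_t -> 'I_n, injective idx ->
      forall a : (forall j : 'I_t, 'I_(q (idx j))),
      (count (fun x : vertex => [forall j, x (idx j) == a j]) C)%:R
        = N%:R / \prod_(j < t) (q (idx j))%:R :> rat].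

Definition simple_mset (C : {mset vertex}) : Prop := forall x, (C x <= 1)%N.

End MixedHamming.

(* Main.v *)
From HB Require Import structures.
Require Import Defs.
From mathcomp Require Import all_boot all_order all_algebra finmap multiset.
From mathcomp Require Import ring lra zify.

(* Let [E_T] average a function on the vertices over the coordinates in [T].
   These are commuting self-adjoint projections with [E_S E_T = E_(S u T)], and
   with [B = sum_i E_(i)] and [s = sum_i 1/q_i] the adjacency operator of [H] is
   [Q (B - s)].  If [f] is the multiplicity function of [C], [c = |C| / |V|] and
   [g = f - c], then [C] has strength [t] iff [E_T g = 0] whenever
   [#|T| = n - t].  In that case [<g, B g> <= (n - t - 1) <g, g>], with equality
   only when [B g = (n - t - 1) g].  The bound follows from
   [<f, B f> >= s <f, f>] (adjacency is nonnegative) and [<f, f> >= |C|] (the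
   multiplicities are integers); equality in these two means that [C] is
   independent and simple, and the eigenvector equation counts the edges from
   outside [C].  Conversely, a CR code gives that eigenvector equation, which
   forces [E_T g = 0] for [#|T| = n - t]. *)

Set Implicit Arguments.
Unset Strict Implicit.
Unset Printing Implicit Defensive.

Import Order.TTheory GRing.Theory Num.Theory.
Local Open Scope ring_scope.
Local Open Scope mset_scope.

(** * Commuting projections *)

Section CommutingProjections.

Variables (R : realFieldType) (U : lmodType R) (I : finType).
Variables (dot : U -> U -> R) (E : {set I} -> {linear U -> U}).
Hypothesis dotC : forall u v, dot u v = dot v u.
Hypothesis dotDl : forall u v w, dot (u + v) w = dot u w + dot v w.
Hypothesis dotZl : forall a u w, dot (a *: u) w = a * dot u w.
Hypothesis dot_ge0 : forall u, 0 <= dot u u.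
Hypothesis dot_eq0 : forall u, dot u u = 0 -> u = 0.
Hypothesis E0 : forall u, E set0 u = u.
Hypothesis EU : forall S T u, E S (E T u) = E (S :|: T) u.
Hypothesis Edot : forall S u v, dot (E S u) v = dot u (E S v).

Local Notation E1 i := (E [set i]).

Let dotDr u v w : dot u (v + w) = dot u v + dot u w.
Proof. by rewrite dotC dotDl !(dotC u). Qed.

Let dot0l u : dot 0 u = 0.
Proof. by rewrite -(scale0r 0) dotZl mul0r. Qed.

Let dot_suml (J : finType) (P : pred J) (F : J -> U) v :
  dot (\sum_(j | P j) F j) v = \sum_(j | P j) dot (F j) v.
Proof. by apply: (big_morph (dot^~ v)) => [u w|]; rewrite ?dotDl ?dot0l. Qed.

Let E1K i u : E1 i (E1 i u) = E1 i u.
Proof. by rewrite EU setUid. Qed.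

Let E1C i S u : E1 i (E S u) = E S (E1 i u).
Proof. by rewrite !EU setUC. Qed.

(** The self-adjoint idempotent [E1 i] kills [u - E1 i u], so its range is orthogonal to its kernel
    and the cross terms vanish. *)
Let dot_split i u v :
  dot u v = dot (E1 i u) (E1 i v) + dot (u - E1 i u) (v - E1 i v).
Proof.
have dotDD a b c d : dot (a + b) (c + d) =
    dot a c + dot a d + (dot b c + dot b d).
  by rewrite dotDl !dotDr.
rewrite -[u in LHS](subrKC (E1 i u)) -[v in LHS](subrKC (E1 i v)) [LHS]dotDD.
have -> : dot (E1 i u) (v - E1 i v) = 0.
  by rewrite Edot linearB /= E1K subrr dotC dot0l.
have -> : dot (u - E1 i u) (E1 i v) = 0.
  by rewrite -Edot linearB /= E1K subrr dot0l.
by rewrite addr0 add0r.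
Qed.

(* Splitting [u] into [E1 i u] and [u - E1 i u], on which [E1 i] acts as [1]
   and [0], removes [i] from [T]; the annihilation order drops by one on the
   first summand. *)
Lemma sum_proj_le (T : {set I}) (m : nat) (u : U) :
  (forall S : {set I}, S \subset T -> #|S| = m -> E S u = 0) ->
  dot u (\sum_(i in T) E1 i u) <= (m%:R - 1) * dot u u /\
  (dot u (\sum_(i in T) E1 i u) = (m%:R - 1) * dot u u ->
   \sum_(i in T) E1 i u = (m%:R - 1) *: u).
Proof.
(* Induction on a bound for [#|T|], for all [m] and [u]. For [m = 0] the hypothesis at the empty set
   already gives [u = 0]. *)
have [k] := ubnP #|T|; elim: k T m u => // k IHk T [|m] u;
  rewrite ltnS => leT van.
  have u0 : u = 0 by rewrite -[u]E0 van ?sub0set ?cards0.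
  by rewrite u0 !dot0l mulr0 scaler0 big1 // => i _; rewrite linear0.
have [->|[i iT]] := set_0Vmem T.
  rewrite big_set0 -natr1 addrK dotC dot0l; split=> [|/esym/eqP].
    by rewrite mulr_ge0.
  by rewrite mulf_eq0 => /orP[/eqP->|/eqP/dot_eq0->]; rewrite ?scale0r ?scaler0.
pose T' := T :\ i; pose u1 := E1 i u; pose u0 := u - u1.
have leT' : (#|T'| < k)%N by move: leT; rewrite (cardsD1 i) iT.
have sT' : T' \subset T by apply: subD1set.
(* If [S] lies in [T'] and has [m] elements, then [E S u1 = E (i |: S) u], where [i |: S] has [m.+1]
   elements. *)
have [le1 eq1] : dot u1 (\sum_(j in T') E1 j u1) <= (m%:R - 1) * dot u1 u1 /\
    (dot u1 (\sum_(j in T') E1 j u1) = (m%:R - 1) * dot u1 u1 ->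
     \sum_(j in T') E1 j u1 = (m%:R - 1) *: u1).
  apply: IHk => // S sS cS; rewrite /u1 -E1C EU; apply: van.
    by rewrite subUset sub1set iT (subset_trans sS).
  by rewrite cardsU1 cS (contraNN (subsetP sS i)) // !inE eqxx.
have [le0 eq0] : dot u0 (\sum_(j in T') E1 j u0) <= (m.+1%:R - 1) * dot u0 u0 /\
    (dot u0 (\sum_(j in T') E1 j u0) = (m.+1%:R - 1) * dot u0 u0 ->
     \sum_(j in T') E1 j u0 = (m.+1%:R - 1) *: u0).
  apply: IHk => // S sS cS; rewrite linearB /= -E1C van ?linear0 ?addr0 //.
  exact: subset_trans sS sT'.
(* The index [i] contributes [u1] itself, which raises the factor [m - 1] on this part back to
   [m]. *)
have B1 : E1 i (\sum_(j in T) E1 j u) = u1 + \sum_(j in T') E1 j u1.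
  rewrite linear_sum (big_setD1 i) //= E1K; congr (_ + _).
  by apply: eq_bigr => j _; rewrite E1C.
have Bu0 : \sum_(j in T) E1 j u - E1 i (\sum_(j in T) E1 j u) =
          \sum_(j in T') E1 j u0.
  rewrite B1 (big_setD1 i) //= opprD addrACA subrr add0r -sumrB.
  by apply: eq_bigr => j _; rewrite linearB.
rewrite (dot_split i u (\sum_(i in T) _)) (dot_split i u u) Bu0 B1 -/u1 -/u0.
rewrite dotDr; move: le1 le0 eq1 eq0; rewrite -natr1.
set a1 := dot u1 u1; set a0 := dot u0 u0.
set b1 := dot u1 _; set b0 := dot u0 _ => le1 le0 eq1 eq0; split; first by lra.
(* The goal's inequality is the sum of the two inductive ones, so equality in it forces equality in
   both. *)
move=> eqs; have {}eq1 := eq1 ltac:(lra); have {}eq0 := eq0 ltac:(lra).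
rewrite -[LHS](subrKC (E1 i (\sum_(j in T) E1 j u))) Bu0 B1 eq1 eq0.
rewrite -{1}[u1]scale1r -scalerDl subrKC addrK -scalerDr.
by rewrite /u0 subrKC.
Qed.

(** The vector [h = E S u] satisfies the same equation. The [m] projections indexed by [S] fix [h]
    and the others are positive semidefinite, so [m * dot h h <= (m - 1) * dot h h]. *)
Lemma sum_proj_eigen (m : nat) (u : U) (S : {set I}) :
  \sum_i E1 i u = (m%:R - 1) *: u -> #|S| = m -> E S u = 0.
Proof.
move=> eig cS; pose h := E S u; apply: dot_eq0; rewrite -/h.
have : \sum_i E1 i h = (m%:R - 1) *: h.
  rewrite -linearZ /= -eig linear_sum; apply: eq_bigr => i _; exact: E1C.
rewrite (bigID (mem S)) /= => /(congr1 (dot^~ h)).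
have -> : \sum_(i in S) E1 i h = m%:R *: h.
  rewrite scaler_nat -cS -sumr_const; apply: eq_bigr => i iS.
  by rewrite /h EU (setUidPr _) // sub1set.
rewrite dotDl !dotZl dot_suml => eqh.
have ge0 : 0 <= \sum_(i | i \notin S) dot (E1 i h) h.
  by apply: sumr_ge0 => i _; rewrite -E1K Edot.
by apply/eqP; rewrite eq_le dot_ge0 andbT; lra.
Qed.

End CommutingProjections.

(** * Averaging over coordinates *)

Section Averages.

Variables (n : nat) (q : 'I_n -> nat).
Hypothesis q_gt0 : forall i, (0 < q i)%N.

Implicit Types (S T : {set 'I_n}) (x y z : vertex q) (C : {mset vertex q}).

Definition agree_off T x y := [forall i, (i \in T) || (x i == y i)].

Definition box_size T : rat := \prod_(i in T) (q i)%:R.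

(* [rat^o] rather than [rat], so that this is an [lmodType rat]. *)
Definition vfun := {ffun vertex q -> rat^o}.

Implicit Types f g : vfun.

Definition avg T f : vfun :=
  [ffun x => (box_size T)^-1 * \sum_(y | agree_off T x y) f y].

Definition dotv f g : rat := \sum_x f x * g x.

Lemma agree_off_refl T : reflexive (agree_off T).
Proof. by move=> x; apply/forallP => i; rewrite eqxx orbT. Qed.

Lemma agree_off_sym T : symmetric (agree_off T).
Proof. by move=> x y; apply: eq_forallb => i; rewrite eq_sym. Qed.

Lemma agree_off0 x y : agree_off set0 x y = (x == y).
Proof.
apply/forallP/eqP => [xy|-> i]; last by rewrite eqxx orbT.
by apply/ffunP => i; have := xy i; rewrite inE => /eqP.
Qed.

Lemma box_size_gt0 T : 0 < box_size T.
Proof. by apply: prodr_gt0 => i _; rewrite ltr0n. Qed.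

Lemma box_sizeUI S T :
  box_size S * box_size T = box_size (S :|: T) * box_size (S :&: T).
Proof.
have box T' : box_size T' = \prod_i (if i \in T' then (q i)%:R else 1).
  by rewrite /box_size big_mkcond.
rewrite !box -!big_split; apply: eq_bigr => i _ /=.
by rewrite !inE; case: (i \in S); case: (i \in T); rewrite /= ?mulr1 ?mul1r.
Qed.

Lemma box_sizeC T : box_size T * box_size (~: T) = \prod_i (q i)%:R.
Proof.
rewrite box_sizeUI setUCr setICr {2}/box_size big_set0 mulr1.
by apply: eq_bigl => i; rewrite inE.
Qed.

(** An intermediate [z] is forced to follow [x] off [S] and [y] off [T]. It is therefore free
    exactly on [S :&: T], and exists only if [x] and [y] agree off [S :|: T]. *)
Lemma card_agree_off2 S T x y :
  #|[pred z | agree_off S x z && agree_off T z y]|%:R =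
  (agree_off (S :|: T) x y)%:R * box_size (S :&: T).
Proof.
(* The coordinates of [z] are constrained independently, so the count is a product over [i]. *)
pose F i := [pred a : 'I_(q i) | ((i \in S) || (x i == a)) &&
                                 ((i \in T) || (a == y i))].
have -> : #|[pred z | agree_off S x z && agree_off T z y]| =
    #|(family F : {pred vertex q})|.
  apply: eq_card => z; rewrite inE.
  apply/andP/familyP => [[/forallP xz /forallP zy] i|zF].
    by rewrite inE xz zy.
  by split; apply/forallP => i; have := zF i; rewrite inE => /andP[].
rewrite card_family foldrE big_map big_enum /= natr_prod.
have cF i : #|F i|%:R = (if i \in S :&: T then (q i)%:R else
                        ((i \in S :|: T) || (x i == y i))%:R) :> rat.
  rewrite !inE; have [iS|iS] := boolP (i \in S);
    have [iT|iT] := boolP (i \in T) => /=.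
  - rewrite -(@eq_card 'I_(q i) predT) ?card_ord // => a.
    by rewrite !inE iS iT.
  - rewrite (@eq_card1 _ (y i)) // => a.
    by rewrite !inE iS (negPf iT).
  - rewrite (@eq_card1 _ (x i)) // => a.
    by rewrite !inE iT (negPf iS) andbT eq_sym.
  - have [xy|xy] := eqVneq (x i) (y i).
      rewrite (@eq_card1 _ (x i)) // => a.
      by rewrite !inE (negPf iS) (negPf iT) /= -xy eq_sym andbb.
    rewrite eq_card0 // => a; rewrite !inE (negPf iS) (negPf iT) /=.
    by apply/negP => /andP[/eqP <-]; apply/negP.
rewrite (eq_bigr _ (fun i _ => cF i)).
have [xy|] := boolP (agree_off _ x y).
  rewrite mul1r /box_size [RHS]big_mkcond; apply: eq_bigr => i _.
  by rewrite (forallP xy).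
rewrite negb_forall mul0r => /existsP[i xyi]; rewrite (bigD1 i) //=.
move: xyi; rewrite !inE !negb_or => /andP[/andP[/negPf-> /negPf->] /negPf->].
by rewrite mul0r.
Qed.

Lemma card_agree_off T x : #|[pred y | agree_off T x y]|%:R = box_size T.
Proof.
have := card_agree_off2 T T x x; rewrite agree_off_refl setIid mul1r => <-.
by congr _%:R; apply: eq_card => y; rewrite !inE (agree_off_sym _ y) andbb.
Qed.

Lemma card_vertex : #|{: vertex q}|%:R = \prod_(i < n) (q i)%:R :> rat.
Proof.
by rewrite card_dep_ffun foldrE big_map big_enum /= natr_prod;
  apply: eq_bigr => i _; rewrite card_ord.
Qed.

Lemma avg_is_linear T : linear (avg T).
Proof.
move=> a f g; apply/ffunP => x; rewrite !ffunE.
rewrite (eq_bigr (fun y => a * f y + g y)) => [|y _]; last by rewrite !ffunE.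
by rewrite big_split /= -mulr_sumr mulrDr mulrCA.
Qed.

HB.instance Definition _ T :=
  GRing.isLinear.Build rat vfun vfun _ (avg T) (avg_is_linear T).

Lemma avg0 f : avg set0 f = f.
Proof.
apply/ffunP => x; rewrite ffunE /box_size big_set0 invr1 mul1r.
by rewrite (big_pred1 x) // => y; rewrite agree_off0 eq_sym.
Qed.

Lemma avgU S T f : avg S (avg T f) = avg (S :|: T) f.
Proof.
apply/ffunP => x; rewrite !ffunE.
under eq_bigr do rewrite ffunE.
rewrite -mulr_sumr mulrA -invfM box_sizeUI.
have -> : \sum_(z | agree_off S x z) \sum_(y | agree_off T z y) f y =
    \sum_(y | agree_off (S :|: T) x y) box_size (S :&: T) * f y.
  rewrite (exchange_big_dep xpredT) //= [RHS]big_mkcond; apply: eq_bigr => y _.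
  rewrite sumr_const -mulr_natl card_agree_off2.
  by case: ifP; rewrite ?mul1r ?mul0r.
rewrite -mulr_sumr mulrA invfM divfK // gt_eqF //; exact: box_size_gt0.
Qed.

Lemma avg_dotv T f g : dotv (avg T f) g = dotv f (avg T g).
Proof.
rewrite /dotv.
under eq_bigr do rewrite ffunE -mulrA mulr_suml mulr_sumr.
under [RHS]eq_bigr do rewrite ffunE mulrCA mulr_sumr mulr_sumr.
rewrite (exchange_big_dep xpredT) //=; apply: eq_bigr => y _.
by apply: eq_bigl => x; rewrite agree_off_sym.
Qed.

Lemma dotvC f g : dotv f g = dotv g f.
Proof. by apply: eq_bigr => x _; rewrite mulrC. Qed.

Lemma dotvDl f g h : dotv (f + g) h = dotv f h + dotv g h.
Proof.
by rewrite /dotv -big_split; apply: eq_bigr => x _; rewrite ffunE mulrDl.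
Qed.

Lemma dotvZl a f g : dotv (a *: f) g = a * dotv f g.
Proof.
by rewrite /dotv mulr_sumr; apply: eq_bigr => x _; rewrite ffunE -mulrA.
Qed.

Lemma dotv_ge0 f : 0 <= dotv f f.
Proof. by apply: sumr_ge0 => x _; rewrite -expr2 sqr_ge0. Qed.

Lemma dotv_eq0 f : dotv f f = 0 -> f = 0.
Proof.
move/eqP; rewrite psumr_eq0 => [/allP f0|x _]; last by rewrite -expr2 sqr_ge0.
apply/ffunP => x; have := f0 x (mem_index_enum x).
by rewrite ffunE /= -expr2 sqrf_eq0 => /eqP.
Qed.

(** * Constant functions, the operator [B], and centering *)

Definition cstv (c : rat) : vfun := [ffun=> c].

Lemma vfunD f g x : (f + g) x = (f x : rat) + (g x : rat) :> rat.
Proof. by rewrite ffunE. Qed.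

Lemma vfunB f g x : (f - g) x = (f x : rat) - (g x : rat) :> rat.
Proof. by rewrite !ffunE. Qed.

Lemma vfunZ (a : rat) f x : (a *: f) x = a * (f x : rat) :> rat.
Proof. by rewrite ffunE. Qed.

Lemma cstvE c x : cstv c x = c :> rat.
Proof. by rewrite ffunE. Qed.

(** The operator [B] of the overview; [inv_sum] below is its [s], that is, [n] divided by the
    harmonic mean. *)
Definition avg_sum f : vfun := \sum_i avg [set i] f.

Definition total f : rat := \sum_x f x.

Definition inv_sum : rat := \sum_(i < n) (q i)%:R^-1.

Local Notation V := (\prod_(i < n) (q i)%:R : rat).

Lemma avg_cst T c : avg T (cstv c) = cstv c.
Proof.
apply/ffunP => x; rewrite !ffunE; under eq_bigr do rewrite ffunE.
rewrite sumr_const -mulr_natl card_agree_off mulKf // gt_eqF //.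
exact: box_size_gt0.
Qed.

Lemma avg_sum_cst c : avg_sum (cstv c) = cstv (n%:R * c).
Proof.
rewrite /avg_sum; under eq_bigr do rewrite avg_cst.
by apply/ffunP => x; rewrite sum_ffunE sumr_const card_ord !ffunE mulr_natl.
Qed.

Lemma avg_sumD f g : avg_sum (f + g) = avg_sum f + avg_sum g.
Proof. by rewrite -big_split; apply: eq_bigr => i _; rewrite linearD. Qed.

Lemma avg_sum_dotv f g : dotv (avg_sum f) g = dotv f (avg_sum g).
Proof.
rewrite /avg_sum; elim/big_rec2: _ => [|i h1 h2 _ IH].
  by rewrite /dotv !big1 // => x _; rewrite ffunE ?mul0r ?mulr0.
by rewrite dotvDl avg_dotv IH [RHS]dotvC dotvDl !(dotvC _ f).
Qed.

Lemma dotv_cst f c : dotv f (cstv c) = c * total f.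
Proof.
by rewrite /total mulr_sumr; apply: eq_bigr => x _; rewrite ffunE mulrC.
Qed.

Lemma V_gt0 : 0 < V.
Proof. by apply: prodr_gt0 => i _; rewrite ltr0n. Qed.

Section Centering.

Variable f : vfun.
Let c : rat := total f / V.
Let g : vfun := f - cstv c.

Lemma center_avg T : (avg T g = 0) <-> (avg T f = cstv c).
Proof.
by rewrite linearB /= avg_cst; split=> [/subr0_eq|->]; rewrite ?subrr.
Qed.

Lemma center_avg_sum : avg_sum f = avg_sum g + cstv (n%:R * c).
Proof. by rewrite -avg_sum_cst -avg_sumD subrK. Qed.

Lemma dotv_center_cst a : dotv g (cstv a) = 0.
Proof.
rewrite dotv_cst /total /g; under eq_bigr do rewrite !ffunE.
rewrite sumrB sumr_const -mulr_natr card_vertex divfK ?subrr ?mulr0 //.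
by rewrite gt_eqF ?V_gt0.
Qed.

Lemma center_dotv : dotv f f = dotv g g + c * total f.
Proof.
rewrite -{1 2}(subrK (cstv c) f) -/g dotvDl dotvC dotvDl dotvC dotv_center_cst.
by rewrite addr0 (dotvC (cstv c)) subrK dotv_cst.
Qed.

(** The operator is self-adjoint and multiplies constants by [n], and [g] is orthogonal to
    constants, so the cross terms with [g] vanish. *)
Lemma center_dotv_avg_sum :
  dotv f (avg_sum f) = dotv g (avg_sum g) + n%:R * c * total f.
Proof.
rewrite center_avg_sum dotvC dotvDl dotvC (dotvC _ f) dotv_cst; congr (_ + _).
rewrite -{1}(subrK (cstv c) f) -/g dotvDl -(avg_sum_dotv (cstv c)) avg_sum_cst.
by rewrite (dotvC (cstv _)) dotv_center_cst addr0.
Qed.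

(** This is [sum_proj_le] for [g] and all indices with [m = n - t], rewritten in terms of [f]. The
    factor [r] is a rational difference because it equals [-1] when [t = n]. *)
Lemma avg_sum_le (t : nat) : (t <= n)%N ->
  (forall T, #|T| = (n - t)%N -> avg T f = cstv c) ->
  let r := n%:R - t.+1%:R in let s := t.+1%:R * c in
  dotv f (avg_sum f) <= r * dotv f f + s * total f /\
  (dotv f (avg_sum f) = r * dotv f f + s * total f ->
   forall x, avg_sum f x = r * (f x : rat) + s :> rat).
Proof.
move=> tn van r s.
have rE : (n - t)%N%:R - 1 = r by rewrite natrB // /r -natr1; ring.
have [|le_g eq_g] := @sum_proj_le _ vfun _ dotv
  (fun T => avg T : {linear vfun -> vfun})
  dotvC dotvDl dotvZl dotv_ge0 dotv_eq0 avg0 avgU avg_dotv setT (n - t)%N g.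
  by move=> S _ cS; apply/center_avg/van.
have sumE : \sum_(i in setT) avg [set i] g = avg_sum g.
  by apply: eq_bigl => i; rewrite inE.
move: le_g eq_g; rewrite /= sumE rE center_dotv center_dotv_avg_sum.
set w := total f => le_g eq_g.
(* On constants the eigenvalue is [n] instead of [r]; the term in [s] makes up the difference
   [n - r = t + 1]. *)
have eqrs : n%:R * c * w = r * (c * w) + s * w by rewrite /r /s; ring.
split; first by rewrite mulrDr; lra.
move=> eqs; have {}eq_g := eq_g ltac:(lra).
by move=> x; rewrite center_avg_sum eq_g vfunD vfunZ vfunB !cstvE /r /s; ring.
Qed.

(** Subtracting the mean turns the affine equation for [f] into [avg_sum g = r g] with
    [r = n - t - 1], to which [sum_proj_eigen] applies. *)
Lemma avg_sum_eigen (t : nat) : (t <= n)%N ->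
  (forall x, avg_sum f x = (n%:R - t.+1%:R) * (f x : rat) + t.+1%:R * c
     :> rat) ->
  forall T, #|T| = (n - t)%N -> avg T f = cstv c.
Proof.
move=> tn eig T cT; apply/center_avg.
apply: (@sum_proj_eigen _ vfun _ dotv (fun T => avg T : {linear vfun -> vfun})
  dotvDl dotvZl dotv_ge0 dotv_eq0 avgU avg_dotv (n - t)%N g) => //=.
rewrite -/(avg_sum g) natrB //; have := center_avg_sum => /ffunP eqs.
apply/ffunP => x; have := eqs x.
rewrite eig vfunD vfunZ /g vfunB !cstvE -natr1 => eqx.
lra.
Qed.

End Centering.

(** * Orthogonal arrays as a condition on averages *)

Definition multv C : vfun := [ffun x => (C x)%:R].

Lemma count_multv (P : pred (vertex q)) C :
  (count P C)%:R = \sum_(x | P x) (multv C x : rat) :> rat.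
Proof.
under eq_bigr do rewrite ffunE -count_mem_mset.
rewrite -natr_sum; congr _%:R; elim: (C : seq _) => [|a s IHs] /=.
  by rewrite big1.
rewrite big_split /= IHs; congr (_ + _)%N.
rewrite big_mkcond (bigD1 a) //= eqxx big1 ?addn0; first by case: (P a).
by move=> x /negPf xa; rewrite eq_sym xa if_same.
Qed.

Lemma size_multv C : (size C)%:R = total (multv C).
Proof. by rewrite -[size C](count_predT C) count_multv. Qed.

(** Averaging over the complement of the prescribed coordinates sums over exactly the vertices that
    carry the prescribed values; the box has size [V] divided by the product of the prescribed
    [q (idx j)]. *)
Lemma avg_count C t (idx : 'I_t -> 'I_n) (z : vertex q)
    (a : forall j, 'I_(q (idx j))) :
  injective idx -> (forall j, z (idx j) = a j) ->
  avg (~: [set idx j | j : 'I_t]) (multv C) z =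
    (count (fun x : vertex q => [forall j, x (idx j) == a j]) C)%:R *
      (\prod_(j < t) (q (idx j))%:R) / V :> rat.
Proof.
move=> inj_idx za; rewrite ffunE count_multv.
set T := [set idx j | j : 'I_t].
have <- : box_size T = \prod_(j < t) (q (idx j))%:R.
  rewrite /box_size big_imset /=; last by move=> i j _ _; apply: inj_idx.
  by apply: eq_bigl => j; rewrite inE.
have -> : \sum_(y | agree_off (~: T) z y) multv C y =
    \sum_(x : vertex q | [forall j, x (idx j) == a j]) (multv C x : rat).
  apply: eq_bigl => x; apply/forallP/forallP => [zx j|xa i].
    by have := zx (idx j); rewrite inE imset_f // za eq_sym.
  rewrite inE; case: (boolP (i \in T)) => //= /imsetP[j _ ->].
  by rewrite za eq_sym xa.
rewrite -(box_sizeC T) invfM.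
have h1 := lt0r_neq0 (box_size_gt0 T).
have h2 := lt0r_neq0 (box_size_gt0 (~: T)).
by field; rewrite h1 h2.
Qed.

Lemma ex_vertex_extending t (idx : 'I_t -> 'I_n)
    (a : forall j, 'I_(q (idx j))) :
  injective idx -> exists z : vertex q, forall j, z (idx j) = a j.
Proof.
move=> inj_idx; pose z0 i : 'I_(q i) := Ordinal (q_gt0 i).
(* The value [a j] lives in ['I_(q (idx j))], not in ['I_(q i)]. Passing through [nat] and [insubd]
   avoids a transport, and the default of [insubd] is never reached at [i = idx j]. *)
exists [ffun i => if [pick j | idx j == i] is Some j
                  then insubd (z0 i) (a j : nat) else z0 i].
move=> j; rewrite ffunE; case: pickP => [j' /eqP/inj_idx->|/(_ j)].
  by apply: val_inj; rewrite val_insubd ltn_ord.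
by rewrite eqxx.
Qed.

Lemma ex_idx t T : (t <= n)%N -> #|T| = (n - t)%N ->
  exists2 idx : 'I_t -> 'I_n, injective idx & T = ~: [set idx j | j : 'I_t].
Proof.
move=> tn cT; have cCT : t = #|~: T|.
  by have := cardsC T; rewrite card_ord cT; lia.
exists (fun j => enum_val (cast_ord cCT j)).
  by move=> i j /enum_val_inj/cast_ord_inj.
rewrite -[LHS]setCK; congr (~: _); apply/setP => i; apply/idP/imsetP.
  move=> iT; exists (cast_ord (esym cCT) (enum_rank_in iT i)) => //.
  by rewrite cast_ordKV enum_rankK_in.
by case=> j _ ->; apply: enum_valP.
Qed.

(** By [avg_count], a count of [N] divided by the product of the prescribed [q (idx j)] is the same
    as an average of [N / V]. Sets of size [n - t] correspond to injective [idx] through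
    complements, and every tuple [a] comes from some vertex. *)
Lemma orthogonal_array_avg C t : (t <= n)%N ->
  orthogonal_array (size C) t C <->
  C != mset0 /\
  forall T, #|T| = (n - t)%N -> avg T (multv C) = cstv (total (multv C) / V).
Proof.
move=> tn; rewrite -size_multv.
have V0 := lt0r_neq0 V_gt0.
have P0 (idx : 'I_t -> 'I_n) : \prod_(j < t) (q (idx j))%:R != 0 :> rat.
  by apply: lt0r_neq0; apply: prodr_gt0 => j _; rewrite ltr0n.
split=> [[C0 _ oa]|[C0 av]]; split=> //.
  move=> T /(ex_idx tn)[idx inj_idx ->]; apply/ffunP => z.
  rewrite (avg_count C inj_idx (fun j => erefl (z (idx j)))) oa // cstvE.
  by rewrite divfK.
move=> idx inj_idx a; have [z za] := ex_vertex_extending a inj_idx.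
have cT : #|~: [set idx j | j : 'I_t]| = (n - t)%N.
  by rewrite cardsCs setCK card_imset // !card_ord.
have := avg_count C inj_idx za.
rewrite av // cstvE => /(mulIf (invr_neq0 V0)) ->.
by rewrite mulfK.
Qed.

(** * Edge counts in terms of averages *)

Lemma box_size1 i : box_size [set i] = (q i)%:R.
Proof. by rewrite /box_size big_set1. Qed.

Definition indv (S : {set vertex q}) : vfun := [ffun x => (x \in S)%:R].

(** The box of [x] in direction [i] consists of [x] and its neighbours in that direction, and the
    edge multiplicity [Q / q i] is [Q] times the weight in the average. The subtracted term removes
    [x] itself from every box. *)
Lemma edges_to_avg x (S : {set vertex q}) :
  (edges_to (H q) x S)%:R =
  (lcm_all q)%:R * ((avg_sum (indv S) x : rat) - inv_sum * (indv S x : rat))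
    :> rat.
Proof.
rewrite /edges_to /= /H_mult.
rewrite (exchange_big_dep xpredT) //= natr_sum /avg_sum sum_ffunE /inv_sum.
rewrite mulr_suml -sumrB mulr_sumr; apply: eq_bigr => i _.
have qi0 : (q i)%:R != 0 :> rat by rewrite pnatr_eq0 -lt0n.
have -> : (lcm_all q)%:R = (lcm_all q %/ q i)%N%:R * (q i)%:R :> rat.
  by rewrite -natrM divnK // /lcm_all (bigD1 i) //= dvdn_lcml.
rewrite sum_nat_const natrM mulrC -mulrA; congr (_ * _).
rewrite ffunE box_size1 -mulrBr mulVKf //.
rewrite (bigD1 x) ?agree_off_refl //= addrC addrK.
rewrite -sum1_card natr_sum [RHS](eq_bigr (fun y => (y \in S)%:R)) => [|y _];
  last by rewrite ffunE.
rewrite [LHS]big_mkcond [RHS]big_mkcond; apply: eq_bigr => y _ /=.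
have -> : agree_off [set i] x y && (y != x) = ([set j | x j != y j] == [set i]).
  apply/andP/eqP => [[/forallP xy yx]|/setP xyi].
    apply/setP => j; rewrite !inE; have [->|ji] := eqVneq j i; last first.
      by have := xy j; rewrite inE (negPf ji) /= => ->.
    apply: contraNneq yx => xyi; apply/eqP/ffunP => k.
    have [->//|ki] := eqVneq k i.
    by have := xy k; rewrite inE (negPf ki) => /eqP.
  split; last by apply/eqP => yx; have := xyi i; rewrite yx !inE !eqxx.
  by apply/forallP => j; have := xyi j; rewrite !inE => <-; rewrite orNb.
by rewrite unfold_in; case: (y \in S); case: (_ == _).
Qed.

Lemma lcm_all_gt0 : (0 < lcm_all q)%N.
Proof.
by rewrite /lcm_all; elim/big_ind: _ => // a b a0 b0; rewrite lcmn_gt0 a0.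
Qed.

Lemma edges_to_all x :
  (edges_to (H q) x setT)%:R = (lcm_all q)%:R * (n%:R - inv_sum) :> rat.
Proof.
rewrite edges_to_avg; have -> : indv setT = cstv 1.
  by apply/ffunP => y; rewrite !ffunE inE.
by rewrite avg_sum_cst // !cstvE !mulr1.
Qed.

Lemma edges_toC x (S : {set vertex q}) :
  (edges_to (H q) x (~: S))%:R =
  (lcm_all q)%:R * (n%:R - inv_sum) - (edges_to (H q) x S)%:R :> rat.
Proof.
rewrite -(edges_to_all x) /edges_to [in RHS](bigID (mem S)) /= natrD.
have -> : (\sum_(y in setT | y \in S) H_mult x y = \sum_(y in S) H_mult x y)%N.
  by apply: eq_bigl => y; rewrite inE.
by rewrite addrAC subrr add0r; congr _%:R; apply: eq_bigl => y; rewrite !inE.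
Qed.

(** * Inequalities from nonnegativity and integrality *)

Lemma avg_sum_ge (f : vfun) x : (forall y, 0 <= (f y : rat)) ->
  inv_sum * (f x : rat) <= (avg_sum f x : rat).
Proof.
move=> f0; rewrite /inv_sum /avg_sum sum_ffunE mulr_suml; apply: ler_sum => i _.
rewrite ffunE box_size1 ler_pM2l ?invr_gt0 ?ltr0n //.
rewrite (bigD1 x) ?agree_off_refl //= lerDl; exact: sumr_ge0.
Qed.

Lemma multv_ge0 C x : 0 <= (multv C x : rat).
Proof. by rewrite ffunE ler0n. Qed.

Lemma multv_le_sqr C x : (multv C x : rat) <= (multv C x : rat) * multv C x.
Proof. by rewrite ffunE -natrM ler_nat; nia. Qed.

Lemma total_le_dotv C : total (multv C) <= dotv (multv C) (multv C).
Proof. by apply: ler_sum => x _; apply: multv_le_sqr. Qed.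

(** The nonnegative terms [m ^ 2 - m] sum to zero, so each multiplicity [m] is 0 or 1. *)
Lemma total_eq_dotv C :
  dotv (multv C) (multv C) = total (multv C) -> simple_mset C.
Proof.
move=> eqs x; have /eqP : dotv (multv C) (multv C) - total (multv C) = 0.
  by rewrite eqs subrr.
rewrite -sumrB psumr_eq0 => [/allP/(_ x (mem_index_enum x))|y _]; last first.
  by rewrite subr_ge0 multv_le_sqr.
by rewrite /= subr_eq0 ffunE -natrM eqr_nat;
  case: (C x) => [|[|m]] // /eqP; nia.
Qed.

Lemma simple_multv C : simple_mset C -> multv C = indv [set x in C].
Proof.
move=> simC; apply/ffunP => x; rewrite !ffunE !inE in_mset.
by have := simC x; case: (C x) => [|[]].
Qed.

Lemma size_mset_gt0 (C : {mset vertex q}) : (0 < size C)%N = (C != mset0).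
Proof.
rewrite lt0n size_eq0; congr (~~ _).
apply/eqP/eqP => [C0|->]; last exact: enum_mset0.
by apply/msetP => x; rewrite mset0E -count_mem_mset C0.
Qed.

Lemma dotv_avg_sum_ge C :
  inv_sum * dotv (multv C) (multv C) <= dotv (multv C) (avg_sum (multv C)).
Proof.
rewrite mulr_sumr; apply: ler_sum => x _; rewrite mulrCA.
by rewrite ler_wpM2l ?multv_ge0 // avg_sum_ge // => y; apply: multv_ge0.
Qed.

(** Equality in [dotv_avg_sum_ge] holds termwise, and the factor [multv C x] cancels on the support.
    The conclusion says that no edge joins two elements of [C]. *)
Lemma dotv_avg_sum_eq C :
  dotv (multv C) (avg_sum (multv C)) = inv_sum * dotv (multv C) (multv C) ->
  forall x, x \in C ->
    (avg_sum (multv C) x : rat) = inv_sum * (multv C x : rat).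
Proof.
move=> eqs x xC; set f := multv C in eqs *.
have /eqP : \sum_y (f y : rat) *
    ((avg_sum f y : rat) - inv_sum * (f y : rat)) = 0.
  rewrite -[RHS](subrr (dotv f (avg_sum f))) {2}eqs /dotv mulr_sumr -sumrB.
  by apply: eq_bigr => y _; ring.
rewrite psumr_eq0 => [/allP/(_ x (mem_index_enum x))|y _]; last first.
  rewrite mulr_ge0 ?multv_ge0 // subr_ge0 avg_sum_ge // => z; exact: multv_ge0.
rewrite /= mulf_eq0 subr_eq0 => /orP[|/eqP//].
by rewrite ffunE pnatr_eq0 mset_eq0 xC.
Qed.

(** * The bound and its equality case *)

Section Bound.

Variables (t : nat) (tn : (t <= n)%N) (C : {mset vertex q}).

Local Notation f := (multv C).
Local Notation N := (total f).
Local Notation F := (dotv f f).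
(* [d = - theta_(t+1) / Q] *)
Let d : rat := t.+1%:R - n%:R + inv_sum.

(** The upper bound of [avg_sum_le] meets the lower bound [inv_sum * F]; the coefficient [d] is
    [inv_sum - (n - t - 1)]. *)
Lemma oa_dotv_le : orthogonal_array (size C) t C ->
  d * F <= t.+1%:R * (N / V) * N.
Proof.
move/(orthogonal_array_avg C tn) => [_ /(avg_sum_le tn)[le_f _]].
by have := dotv_avg_sum_ge C; rewrite /d; move: le_f; lra.
Qed.

Lemma oa_bound : orthogonal_array (size C) t C -> V * d / t.+1%:R <= N.
Proof.
move=> oa; have [C0 _ _] := oa; have leF := oa_dotv_le oa.
have N0 : 0 < N by rewrite -size_multv ltr0n size_mset_gt0.
have V0 := V_gt0; rewrite ler_pdivrMr ?ltr0Sn //.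
(* For [d <= 0] the bound is trivial; otherwise [N <= F] can be multiplied by [d], and [N > 0]
   cancelled. *)
have [d0|d0] := lerP d 0.
  apply: (@le_trans _ _ 0); first by rewrite mulr_ge0_le0 // ltW.
  by rewrite mulr_ge0 // ltW.
have : d * N <= t.+1%:R * (N / V) * N.
  by apply: le_trans leF; rewrite ler_pM2l // total_le_dotv.
by rewrite ler_pM2r // mulrA ler_pdivlMr // mulrC (mulrC N).
Qed.

Lemma oa_bound_eq : orthogonal_array (size C) t C -> N = V * d / t.+1%:R ->
  [/\ 0 < d, simple_mset C,
      forall x, x \in C -> (avg_sum f x : rat) = inv_sum * (f x : rat)
    & forall x, x \notin C -> (avg_sum f x : rat) = d].
Proof.
move=> oa eqN; have [C0 _ _] := oa; have leF := oa_dotv_le oa.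
have N0 : 0 < N by rewrite -size_multv ltr0n size_mset_gt0.
have V0 := V_gt0; have t0 : 0 < t.+1%:R :> rat by rewrite ltr0Sn.
have d0 : 0 < d.
  by move: N0; rewrite eqN pmulr_lgt0 ?invr_gt0 // pmulr_rgt0.
(* With this value [oa_dotv_le] becomes [d * F <= d * N], so that all the inequalities used collapse
   to equalities. *)
have eqd : t.+1%:R * (N / V) = d.
  by rewrite eqN; field; rewrite nat1r !gt_eqF.
rewrite eqd ler_pM2l // in leF.
have FN : F = N by apply/le_anti; rewrite leF total_le_dotv.
have [_ /(avg_sum_le tn)[le_f eq_f]] :=
  (orthogonal_array_avg C tn).1 oa.
have ge_f := dotv_avg_sum_ge C; move: le_f eq_f; rewrite /= eqd => le_f eq_f.
have dE : d = t.+1%:R - n%:R + inv_sum by [].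
have eqW : dotv f (avg_sum f) = inv_sum * F.
  by apply/le_anti; rewrite ge_f andbT; move: le_f; rewrite dE FN; lra.
split=> //.
- exact: total_eq_dotv.
- exact: dotv_avg_sum_eq.
- move=> x xC; rewrite eq_f; last by rewrite eqW dE FN; lra.
  by rewrite ffunE (mset_eq0P xC) mulr0 add0r.
Qed.

Lemma oa_of_avg_sum : 0 < d ->
  (forall x, x \in C -> (avg_sum f x : rat) = inv_sum) ->
  (forall x, x \notin C -> (avg_sum f x : rat) = d) -> simple_mset C ->
  orthogonal_array (size C) t C /\ N = V * d / t.+1%:R.
Proof.
move=> d0 inC outC simC; have V0 := V_gt0.
have t0 : 0 < t.+1%:R :> rat by rewrite ltr0Sn.
(* Since [f] is 0 or 1 and [inv_sum = (n - t - 1) + d], one affine formula covers both cases. *)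
have eig x : (avg_sum f x : rat) = (n%:R - t.+1%:R) * (f x : rat) + d.
  rewrite [X in _ * X]ffunE; case: (boolP (x \in C)) => xC; last first.
    by rewrite outC // (mset_eq0P xC) mulr0 add0r.
  have -> : C x = 1%N by have := simC x; move: xC; rewrite in_mset; lia.
  by rewrite inC // /d; lra.
(* Pairing [eig] with the constant 1 gives [n N = (n - t - 1) N + V d]. *)
have eqN : t.+1%:R * N = V * d.
  have := avg_sum_dotv f (cstv 1); rewrite avg_sum_cst // !dotv_cst mul1r mulr1.
  rewrite /total (eq_bigr _ (fun x _ => eig x)) big_split /= -mulr_sumr.
  rewrite sumr_const -[d *+ _]mulr_natl card_vertex -/(total f); lra.
have NE : N = V * d / t.+1%:R by rewrite -eqN mulrAC divff ?mul1r // gt_eqF.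
split=> //; apply/orthogonal_array_avg => //; split.
  by rewrite -size_mset_gt0 -(ltr0n rat) size_multv NE !mulr_gt0 // invr_gt0.
apply: avg_sum_eigen => // x; rewrite eig; congr (_ + _).
by rewrite mulrA eqN mulrAC divff ?mul1r // gt_eqF.
Qed.

End Bound.

End Averages.

Theorem theorem9 (n : nat) (q : 'I_n -> nat) (t : nat)
    (n_ge1 : (1 <= n)%N) (q_ge2 : forall i, (2 <= q i)%N) (t_le_n : (t <= n)%N) :
  let qbar : rat := harmonic_mean q in
  let Q : nat := lcm_all q in
  let bound : rat :=
    (\prod_(i < n) (q i)%:R) * (1 - (1 - 1 / qbar) * (n%:R / t.+1%:R)) in
  let k : rat := Q%:R * n%:R * (1 - 1 / qbar) in
  let theta : rat := k - t.+1%:R * Q%:R in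
  (forall (N : nat) (C : {mset vertex q}),
     orthogonal_array N t C -> bound <= N%:R) /\
  (forall C : {mset vertex q},
     (orthogonal_array (size C) t C /\ (size C)%:R = bound) <->
     (simple_mset C /\ CR_code (H q) k (- theta) [set x in C])).
Proof.
move=> qbar Q bound k theta.
have q_gt0 i : (0 < q i)%N by apply: leq_trans (q_ge2 i).
have n0 : n%:R != 0 :> rat by rewrite pnatr_eq0 -lt0n.
have qbarE : 1 / qbar = inv_sum q / n%:R by rewrite div1r invf_div.
(* This number links the two sides: the bound is [V * d / (t + 1)] and [- theta] is [Q * d]. *)
pose d : rat := t.+1%:R - n%:R + inv_sum q.
have boundE : bound = (\prod_(i < n) (q i)%:R) * d / t.+1%:R.
  rewrite /bound qbarE /d -mulrA; congr (_ * _).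
  by field; rewrite n0 nat1r pnatr_eq0.
have kE : k = Q%:R * (n%:R - inv_sum q) by rewrite /k qbarE; field.
have thetaE : - theta = Q%:R * d by rewrite /theta kE /d; ring.
have Q0 : 0 < Q%:R :> rat by rewrite ltr0n lcm_all_gt0.
(* Each [1 / q i] is below 1 because [q i >= 2], and [n >= 1] makes the sum of these inequalities
   strict. *)
have k0 : 0 < k.
  rewrite kE mulr_gt0 // subr_gt0 /inv_sum.
  rewrite -[X in _ < X%:R]card_ord -sumr_const.
  apply: ltr_sum => [|i _].
    by rewrite has_predT /index_enum -enumT size_enum_ord.
  by rewrite invf_lt1 ?ltr0n ?ltr1n.
split=> [N C oa|C].
  have [_ sz _] := oa; rewrite boundE -sz size_multv oa_bound //.
  by rewrite sz.
rewrite boundE size_multv thetaE; split=> [[oa eqN]|[simC [_ _]]].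
  have [d0 simC inC outC] := oa_bound_eq q_gt0 t_le_n oa eqN.
  have inE' := simple_multv simC; split=> //; split.
  - exists (edges_to (H q) [ffun i => Ordinal (q_gt0 i)] setT) => x.
    by apply/eqP; rewrite -(eqr_nat rat) !edges_to_all.
  - by [].
  - exact: mulr_gt0.
  - move=> x; rewrite inE => xC.
    rewrite edges_toC // edges_to_avg // -inE' inC //.
    by rewrite subrr mulr0 subr0 kE.
  - move=> x; rewrite inE => xC; rewrite edges_to_avg // -inE' outC // ffunE.
    by rewrite (mset_eq0P xC) mulr0 subr0.
(* The clause [0 < c] of [CR_code] yields [0 < d]. As [k] is the full degree, [inC] says that [C] is
   independent. *)
rewrite pmulr_rgt0 // => d0 inC outC; apply: oa_of_avg_sum => // x xC.
  have := inC x.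
  rewrite inE xC edges_toC // edges_to_avg // -simple_multv // -/Q -kE.
  have -> : (multv C x : rat) = 1.
    rewrite ffunE; have := simC x; move: xC; rewrite in_mset.
    by case: (C x) => [|[]].
  move=> /(_ isT)/eqP; rewrite -subr_eq0 addrAC subrr add0r oppr_eq0.
  by rewrite mulf_eq0 gt_eqF //= subr_eq0 mulr1 => /eqP.
have := outC x.
rewrite inE xC edges_to_avg // -simple_multv // ffunE (mset_eq0P xC).
by rewrite mulr0 subr0 => /(_ isT) /(mulfI (lt0r_neq0 Q0)).
Qed.
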